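(* Let $k\ge2$ and let $A=\{a_n\}$ be an infinite set of natural numbers (enumerated increasingly) such that $a_n=o(n^{k/(k-1)})$. Then $R_k(A)=\{x\in\mathbb{N}\mid |A\cap(A+x)|\ge k\}$ is a $\Delta_f$-set, i.e. for every $h$ there is a finite set $Z$ with $|Z|=h$ and $\Delta(Z)\subseteq R_k(A)$.
   Context: Natural numbers are positive integers; $A+x=\{a+x\mid a\in A\}$; $a_n=o(g(n))$ means $a_n/g(n)\to0$. For $X\subseteq\mathbb{N}$, $\Delta(X)=\{x'-x\mid x,x'\in X,\ x'>x\}$. A set $S\subseteq\mathbb{N}$ is a $\Delta_f$-set if for every $h$ there exists $X$ with $|X|=h$ and $\Delta(X)\subseteq S$. *)

(* Defs.v *)
From HB Require Import structures.
From mathcomp Require Import all_boot all_order all_algebra.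
From mathcomp Require Import all_classical all_reals all_analysis.
Set Implicit Arguments.
Unset Strict Implicit.
Unset Printing Implicit Defensive.
Import Order.TTheory GRing.Theory Num.Theory.
Import numFieldNormedType.Exports.
Local Open Scope classical_set_scope.
Local Open Scope card_scope.

(* Natural numbers are positive integers here: subsets of N are the sets of
   type [set nat] included in [posN]. *)
Definition posN : set nat := [set n | (0 < n)%N].

Definition shift (A : set nat) (x : nat) : set nat := [set (a + x)%N | a in A].

Definition Delta (X : set nat) : set nat :=
  [set d | exists x x', [/\ X x, X x', (x < x')%N & d = (x' - x)%N]].

(* [X #= `I_h] says that X is finite with exactly h elements. *)
Definition Delta_f_set (S : set nat) : Prop :=
  S `<=` posN /\
  forall h : nat, (0 < h)%N ->
    exists X : set nat, [/\ X `<=` posN, X #= `I_h & Delta X `<=` S].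

(* [`I_k #<= B] says that B has at least k elements; B may be infinite. *)
Definition Rset (k : nat) (A : set nat) : set nat :=
  [set x | posN x /\ `I_k #<= A `&` shift A x].

(* The enumeration is indexed from 0, so [a n] is the (n+1)-st element of A. *)
Definition increasing_enumeration (A : set nat) (a : nat -> nat) : Prop :=
  (forall m n, (m < n)%N -> (a m < a n)%N) /\ range a = A.

(* Main.v *)
(** The first kq elements of A contain q^k k-subsets with one element in each
    block of q consecutive terms, while their difference patterns lie in a set of
    size N^(k-1), where N = a (k q). As N = o(q^(k/(k-1))), for some q a pattern is
    shared by h such subsets. If Z is the set of their first elements and z < z'
    are in Z, then the subset starting at z' lies in both A and A + (z' - z). *)
Require Import Defs.
From HB Require Import structures.
From mathcomp Require Import all_boot all_order all_algebra.
From mathcomp Require Import all_classical all_reals all_analysis.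
From mathcomp Require Import zify.
Set Implicit Arguments.
Unset Strict Implicit.
Unset Printing Implicit Defensive.
Import Order.TTheory GRing.Theory Num.Theory.
Import numFieldNormedType.Exports.
Local Open Scope classical_set_scope.
Local Open Scope ring_scope.

Lemma pigeonhole_fiber (D T : finType) (f : D -> T) (h : nat) :
  (h * #|T| < #|D|)%N -> exists t, (h < #|[pred x | f x == t]|)%N.
Proof.
move=> hTD; apply: contrapT => /forallNP small.
move: hTD; rewrite ltnNge => /negP; apply.
rewrite -sum1_card (partition_big f predT) //= mulnC -sum_nat_const.
apply: leq_sum => t _; rewrite sum1_card leqNgt; apply/negP; exact: small.
Qed.

(** [g] lists the offsets of a pattern; its injectivity makes the points [z' + g i] with [i < k]
    distinct, so they witness the cardinality bound. *)
Lemma Delta_pattern_Rset (A X : set nat) (k : nat) (g : nat -> nat) :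
  {in `I_k &, injective g} ->
  (forall z i, X z -> (i < k)%N -> A (z + g i)%N) ->
  Delta X `<=` Rset k A.
Proof.
move=> ginj XA d [z [z' [Xz Xz' zz' ->]]]; split; first by rewrite /posN /= subn_gt0.
pose t i := (z' + g i)%N.
have tinj : {in `I_k &, injective t}.
  by move=> i j ik jk /addnI; apply: ginj.
apply: card_le_trans (subset_card_le (A := t @` `I_k) _).
  by have /card_eqPle[] := inj_card_eq tinj.
move=> _ [i ik <-]; split; first exact: XA.
exists (z + g i)%N; first exact: XA.
rewrite /t; lia.
Qed.

(* Here and in [littleo_power_block], [k.+1] is the k of the theorem. *)
Lemma repeated_pattern (a : nat -> nat) (k q h : nat) :
  (forall m n, (m < n)%N -> (a m < a n)%N) ->
  (h * a (k.+1 * q) ^ k < q ^ k.+1)%N ->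
  exists (s : seq nat) (g : nat -> nat),
    [/\ uniq s, size s = h, {subset s <= range a},
        {in `I_k.+1 &, injective g} &
        forall z i, z \in s -> (i < k.+1)%N -> range a (z + g i)%N].
Proof.
move=> amono hq; pose N := a (k.+1 * q)%N.
have ale m n : (m <= n)%N -> (a m <= a n)%N.
  by rewrite leq_eqVlt => /predU1P[-> //|/amono/ltnW].
have ainj : injective a.
  move=> m n amn; case: (ltngtP m n) => // /amono; lia.
(* A function [f] encodes a choice of one term per block: [e f i] is the term chosen in block [i],
   whose indices run from [i * q] to [i * q + q - 1]. *)
pose e (f : {ffun 'I_k.+1 -> 'I_q}) (i : 'I_k.+1) := a (i * q + f i)%N.
have eN f i : (e f i < N)%N.
  apply/amono/(@leq_trans (i.+1 * q)); first by rewrite mulSn addnC ltn_add2r.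
  by rewrite leq_mul2r ltn_ord orbT.
(* This makes the truncated differences [e f i - e f ord0] exact. *)
have e0 f i : (e f ord0 <= e f i)%N.
  apply: ale; case: (unliftP ord0 i) => [j ->|-> //].
  rewrite lift0 mul0n add0n mulSn -addnA.
  exact: leq_trans (ltnW (ltn_ord (f ord0))) (leq_addr _ _).
(* Dividing the index by [q] recovers the block. *)
have einj f i j : e f i = e f j -> i = j.
  move=> /ainj/(congr1 (divn^~ q)); have q0 := leq_ltn_trans (leq0n _) (ltn_ord (f i)).
  by rewrite !divnMDl// !divn_small// !addn0 => /val_inj.
(* The pattern of [f]: the offsets of the other [k] chosen terms from the first one. All are below
   [N], so the codomain has [N ^ k] elements. *)
pose phi f := [ffun i : 'I_k =>
  Ordinal (leq_ltn_trans (leq_subr (e f ord0) _) (eN f (lift ord0 i)))].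
have [|t ht] := @pigeonhole_fiber _ _ phi h.
  by rewrite !card_ffun !card_ord.
(* The strict bound gives a reference choice [f0] in the fiber even when [h = 0]. *)
have /card_gt0P[f0 f0t] := leq_ltn_trans (leq0n h) ht.
have phiE f i : phi f = t -> e f i = (e f ord0 + (e f0 i - e f0 ord0))%N.
  move=> ft; case: (unliftP ord0 i) => [j ->|->]; last by lia.
  have : phi f = phi f0 by rewrite ft; move: f0t; rewrite inE => /eqP.
  move=> /ffunP/(_ j); rewrite !ffunE => /(congr1 val) /= <-.
  by have := e0 f (lift ord0 j); lia.
pose P := take h (enum [pred f | phi f == t]).
have Pt f : f \in P -> phi f = t.
  by move=> /mem_take; rewrite mem_enum inE => /eqP.
exists (map (e^~ ord0) P), (fun i => e f0 (inord i) - e f0 ord0)%N; split.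
(* Within the fiber, the first term and the common pattern determine all terms, hence [f]. *)
- rewrite map_inj_in_uniq ?take_uniq ?enum_uniq// => f f' /Pt ft /Pt f't ff'.
  apply/ffunP => i; apply: val_inj => /=.
  have : e f i = e f' i by rewrite (phiE f)// (phiE f')// ff'.
  by move=> /ainj/addnI.
- by rewrite size_map size_takel// -cardE ltnW.
- by move=> _ /mapP[f _ ->]; rewrite inE; exists ((ord0 : 'I_k.+1) * q + f ord0)%N.
- move=> i j; rewrite !inE/= => ik jk ij.
  have : e f0 (inord i) = e f0 (inord j).
    have := e0 f0 (inord i); have := e0 f0 (inord j); lia.
  by move=> /einj/(congr1 val)/=; rewrite !inordK.
- by move=> _ i /mapP[f /Pt ft ->] _; rewrite -phiE.
Qed.

(** Put [n = k.+1 * q]. Then [a n ^ k] is at most a small multiple of [n.+1 ^ k.+1], while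
    [n.+1 <= k.+2 * q] as soon as [q] is positive. *)
Lemma littleo_power_block (R : realType) (a : nat -> nat) (k h : nat) :
  (0 < k)%N ->
  (fun n : nat => (a n)%:R / (n.+1%:R `^ (k.+1%:R / k%:R)) : R) @ \oo
    --> (0 : R) ->
  exists q, (h * a (k.+1 * q) ^ k < q ^ k.+1)%N.
Proof.
(* The factor [k.+2 ^ k.+1] absorbs the passage from [n.+1] to [q]. *)
move=> k0 ho; pose c := (h * k.+2 ^ k.+1)%N.
have c0 : 0 < c.+1%:R^-1 :> R by rewrite invr_gt0 ltr0n.
have /cvgr0Pnorm_lt/(_ _ c0)[M _ hM] := ho.
exists M.+1; set n := (k.+1 * M.+1)%N.
have /hM : (M <= n)%N by rewrite /n; nia.
set p : R := _ `^ _ => /= an; have p0 : 0 < p by rewrite powR_gt0.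
have {}an : (a n)%:R < c.+1%:R^-1 * p.
  by rewrite -ltr_pdivrMr//; apply: le_lt_trans an; exact: ler_norm.
have pk : p ^+ k = n.+1%:R ^+ k.+1.
  rewrite -powR_mulrn ?ltW// /p -powRrM mulfVK ?pnatr_eq0 -?lt0n//.
  by rewrite powR_mulrn.
have ank : c.+1%:R * (a n)%:R ^+ k <= n.+1%:R ^+ k.+1 :> R.
  rewrite -pk -ler_pdivlMl//.
  apply: (@le_trans _ _ ((c.+1%:R^-1 * p) ^+ k)).
    by rewrite lerXn2r ?nnegrE ?ler0n ?mulr_ge0 ?(ltW an) ?(ltW c0) ?(ltW p0).
  rewrite exprMn ler_wpM2r ?exprn_ge0 ?(ltW p0)//.
  (* As [c.+1%:R^-1] is at most 1 and [k] is positive, its [k]-th power is at most itself. *)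
  by rewrite -[leRHS]expr1 ler_wiXn2l ?(ltW c0)// invf_le1 ?ler1n.
have {}ank : (c.+1 * a n ^ k <= n.+1 ^ k.+1)%N.
  by rewrite -(ler_nat R) natrM !natrX.
have nq : (n.+1 ^ k.+1 <= k.+2 ^ k.+1 * M.+1 ^ k.+1)%N.
  by rewrite -expnMn leq_exp2r// /n; nia.
have K0 : (0 < k.+2 ^ k.+1)%N by rewrite expn_gt0.
have Q0 : (0 < M.+1 ^ k.+1)%N by rewrite expn_gt0.
(* Strictness comes from [c < c.+1] when [a n ^ k] is positive, and from [0 < q ^ k.+1]
   otherwise. *)
have [->|x0] := posnP (a n ^ k)%N; first by rewrite muln0.
rewrite -(ltn_pmul2l K0); apply: leq_trans (leq_trans ank nq).
by rewrite mulnA (mulnC _ h) ltn_pmul2r.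
Qed.

Theorem theorem3p3 (R : realType) (k : nat) (A : set nat) (a : nat -> nat)
    (hk : (2 <= k)%N)
    (hA : A `<=` posN)
    (hinf : infinite_set A)
    (henum : increasing_enumeration A a)
    (ho : (fun n : nat =>
             (a n)%:R / (n.+1%:R `^ (k%:R / (k%:R - 1))) : R) @ \oo --> (0 : R)) :
  Delta_f_set (Rset k A).
Proof.
split=> [x []//|h _]; case: henum => amono aA.
(* Replacing [k] by [k.+1] turns the exponent into [k.+1 / k]. *)
case: k hk ho => // k; rewrite ltnS => k0.
have -> : k.+1%:R - 1 = k%:R :> R by rewrite -natr1 addrK.
move=> ho.
have [q hq] := littleo_power_block h k0 ho.
have [s [g [us sh sa ginj sg]]] := repeated_pattern amono hq.
have sinj : {in `I_h &, injective (nth 0%N s)}.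
  move=> i j; rewrite !inE/= -sh => ih jh /eqP.
  by rewrite nth_uniq// => /eqP.
(* The default 0 is never returned, since [s] has size [h]. *)
exists (nth 0%N s @` `I_h); split.
- move=> _ [i ih <-]; apply: hA; rewrite -aA.
  by apply/set_mem/sa/mem_nth; rewrite sh.
- exact: inj_card_eq.
- apply: (Delta_pattern_Rset ginj) => _ i [j jh <-] ik; rewrite -aA.
  by apply: sg => //; apply: mem_nth; rewrite sh.
Qed.
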